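(* Let $n\geqq2$. We have $$\kappa_B(\omega,t,2\pi\tau\eta,2\pi\tau)=(t\omega-\eta-i\tau\omega,\;2\pi\tau\omega)$$ for $(\omega,t,2\pi\tau\eta,2\pi\tau)\in T^*(\mathbb{P}^n)$, and $$\kappa_B^{-1}(x-i\xi,2\pi\xi)=\pm\left(\frac{\xi}{|\xi|},\;\frac{x\xi}{|\xi|},\;2\pi|\xi|\left(-x+\frac{(x\xi)\xi}{|\xi|^2}\right),\;2\pi|\xi|\right)$$ for $(x,\xi)\in T^*(\mathbb{R}^n)\setminus0$.
   Context: For $z,\zeta\in\mathbb{C}^n$ write $z\zeta:=z_1\zeta_1+\dots+z_n\zeta_n$ (bilinear, no conjugation) and $z^2:=zz$. $T^*(\mathbb{R}^n)\setminus0$ is the set of $(x,\xi)\in\mathbb{R}^n\times\mathbb{R}^n$ with $\xi\ne0$. $\mathbb{P}^n$, the set of all hyperplanes $\{x\in\mathbb{R}^n:x\omega=t\}$, is the quotient of $\mathbb{S}^{n-1}\times\mathbb{R}$ in which $(\omega,t)$ and $(-\omega,-t)$ are identified; in particular $(\xi/|\xi|,x\xi/|\xi|)=-(\xi/|\xi|,x\xi/|\xi|)$ in $\mathbb{P}^n$. Its cotangent bundle is $$T^*(\mathbb{P}^n)=\{(\omega,t,\eta,\tau):(\omega,t)\in\mathbb{P}^n,\ \eta\in\omega^\perp,\ \tau\in\mathbb{R}\},$$ where $\omega^\perp$ is the orthogonal complement of $\omega$ in $\mathbb{R}^n$. Let $\phi(z,\omega,t):=i\pi(z\omega-t)^2$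 for $z\in\mathbb{C}^n$, $(\omega,t)\in\mathbb{P}^n$. The canonical transform $\kappa_B$ is defined by $$\kappa_B:T^*(\mathbb{P}^n)\ni\bigl(\omega,t,-\phi'_\zeta(z,\omega,t)\bigr)\mapsto\bigl(z,\phi'_z(z,\omega,t)\bigr)\in\mathbb{C}^n\times\mathbb{C}^n.$$ Here $\zeta$ denotes local coordinates of $\mathbb{P}^n$ (for example $\zeta=(\omega_1,\dots,\omega_{n-1},t)$ where $\omega_1^2+\dots+\omega_{n-1}^2<1/2$), $\phi'_\zeta$ and $\phi'_z$ are the gradients in $\zeta$ and $z$, and $-\phi'_\zeta$ is expressed invariantly, independently of the choice of local coordinates, as an element of $\omega^\perp\times\mathbb{R}$. The image is $\kappa_B(T^*(\mathbb{P}^n))=\Lambda_\Phi:=\{(z,-2i\Phi'_z(z)):z\in\mathbb{C}^n\}=\{(x-i\xi,2\pi\xi):(x,\xi)\in\mathbb{R}^n\times\mathbb{R}^n\}$, where $\Phi(z):=\sup_{(\omega,t)\in\mathbb{P}^n}\{-\operatorname{Im}\phi(z,\omega,t)\}=\pi(\operatorname{Im}z)^2$.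
   Formalization: For τ=0 the covector does not determine η, so κ_B is multivalued: η∈ω^⊥ is assumed, equality is claimed for τ≠0, and for τ=0 the right side is shown to be a value of κ_B, the values lying in Λ_Φ being exactly those of the formula as η ranges over ω^⊥. *)

(* Defs.v *)
From HB Require Import structures.
From mathcomp Require Import all_boot all_order all_algebra.
From mathcomp Require Import generic_quotient complex.
From mathcomp Require Import all_classical all_reals all_analysis.
Set Implicit Arguments.
Unset Strict Implicit.
Unset Printing Implicit Defensive.
Import Order.TTheory GRing.Theory Num.Theory.
Import numFieldNormedType.Exports.
Local Open Scope classical_set_scope.
Local Open Scope quotient_scope.
Local Open Scope complex_scope.
Local Open Scope ring_scope.

(* The bilinear product: no conjugation when K = R[i]. *)
Definition dot (K : pzSemiRingType) (n : nat) (u v : 'rV[K]_n) : K :=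
  \sum_(k < n) u 0 k * v 0 k.

(* The norm `|x| that the library puts on matrices is the sup norm. *)
Definition enorm (R : rcfType) (n : nat) (x : 'rV[R]_n) : R :=
  Num.sqrt (dot x x).

Definition cvec (R : pzRingType) (n : nat) (x : 'rV[R]_n) : 'rV[R[i]]_n :=
  map_mx (real_complex R) x.

Section CotangentBundle.
Variables (R : realType) (n : nat).

Definition covec : Type := 'rV[R]_n * R * 'rV[R]_n * R.

Definition is_covec (q : covec) : bool :=
  let: (omega, _, eta, _) := q in (dot omega omega == 1) && (dot eta omega == 0).

(* T^*(S^{n-1} x R) *)
Definition cotS : Type := {q : covec | is_covec q}.
HB.instance Definition _ := Choice.on cotS.

(* The antipodal map (omega, t) |-> (- omega, - t) lifts to covectors as
   (omega, t, eta, tau) |-> - (omega, t, eta, tau). *)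
Definition antipodal (p q : cotS) : bool := (val p == val q) || (val p == - val q).

Lemma antipodal_refl : reflexive antipodal.
Proof. by move=> p; rewrite /antipodal eqxx. Qed.

Lemma antipodal_sym : symmetric antipodal.
Proof.
by move=> p q; rewrite /antipodal eq_sym; congr (_ || _); rewrite -eqr_oppLR eq_sym.
Qed.

Lemma antipodal_trans : transitive antipodal.
Proof.
move=> q p r /orP[]/eqP pq /orP[]/eqP qr; rewrite /antipodal pq qr ?opprK ?eqxx //.
- by rewrite orbT.
- by rewrite orbT.
Qed.

Canonical antipodal_equiv :=
  EquivRel antipodal antipodal_refl antipodal_sym antipodal_trans.

(* T^*(P^n) *)
Definition cotP : Type := {eq_quot antipodal}.

Definition cotP_class (q : cotS) : cotP := \pi_{eq_quot antipodal} q.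

End CotangentBundle.

Section CanonicalTransform.
Variables (R : realType) (n : nat).

Definition phi (z : 'rV[R[i]]_n) (omega : 'rV[R]_n) (t : R) : R[i] :=
  'i * (pi : R)%:C * (dot z (cvec omega) - t%:C) ^+ 2.

Definition cgrad (f : 'rV[R[i]]_n -> R[i]) (z : 'rV[R[i]]_n) : 'rV[R[i]]_n :=
  \row_k ('D_(delta_mx 0 k) (f : 'rV[R[i]]_n -> R[i]^o) z).

Definition rgrad (f : 'rV[R]_n -> R[i]) (u : 'rV[R]_n) : 'rV[R[i]]_n :=
  \row_k ('D_(delta_mx 0 k) (fun y => complex.Re (f y)) u +i*
          'D_(delta_mx 0 k) (fun y => complex.Im (f y)) u).

(* [P] is the inverse of a C^1 local coordinate system zeta of the
   n-dimensional manifold S^{n-1} x R around (omega, t) = P u: a C^1 map into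
   S^{n-1} x R with injective differential is a local diffeomorphism.  Since
   S^{n-1} x R -> P^n is a local diffeomorphism too, these are also the local
   coordinates of P^n. *)
Definition local_coord (P : 'rV[R]_n -> 'rV[R]_n * R) (u : 'rV[R]_n)
    (omega : 'rV[R]_n) (t : R) : Prop :=
  [/\ P u = (omega, t),
      (\forall y \near u, dot (P y).1 (P y).1 = 1),
      (\forall y \near u, differentiable P y /\
         forall v : 'rV[R]_n, {for y, continuous (fun x => 'D_v P x)}) &
      forall v : 'rV[R]_n, 'D_v P u = 0 -> v = 0].

(* (eta, tau) is the invariant expression of - phi'_zeta(z, omega, t): for any
   local coordinates zeta, the covector (eta, tau) of omega^\perp x R has
   components - d phi / d zeta_k in these coordinates. *)
Definition neg_phi_zeta (z : 'rV[R[i]]_n) (omega : 'rV[R]_n) (t : R)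
    (eta : 'rV[R]_n) (tau : R) : Prop :=
  forall (P : 'rV[R]_n -> 'rV[R]_n * R) (u : 'rV[R]_n),
    local_coord P u omega t ->
    forall k : 'I_n,
      let dP := 'D_(delta_mx 0 k) P u in
      (dot eta dP.1 + tau * dP.2)%:C =
      - rgrad (fun y => phi z (P y).1 (P y).2) u 0 k.

(* kappa_B as the set of its values at p.  It is single-valued away from the
   zero section only: at (omega, t, 0, 0) all z with z omega = t occur. *)
Definition kappaB (p : cotP R n) : set ('rV[R[i]]_n * 'rV[R[i]]_n) :=
  [set w | exists (q : cotS R n) (z : 'rV[R[i]]_n),
     let: (omega, t, eta, tau) := val q in
     [/\ cotP_class q = p, neg_phi_zeta z omega t eta tau &
         w = (z, cgrad (fun z' => phi z' omega t) z)]].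

Definition Lambda_Phi : set ('rV[R[i]]_n * 'rV[R[i]]_n) :=
  [set w | exists x xi : 'rV[R]_n,
     w = (cvec x - 'i *: cvec xi, (2 * pi : R)%:C *: cvec xi)].

End CanonicalTransform.

(* Main.v *)
Require Import Defs.
From HB Require Import structures.
From mathcomp Require Import all_boot all_order all_algebra.
From mathcomp Require Import complex ring lra.
From mathcomp Require Import all_classical all_reals all_analysis.
Set Implicit Arguments.
Unset Strict Implicit.
Unset Printing Implicit Defensive.
Import Order.TTheory GRing.Theory Num.Theory.
Import numFieldNormedType.Exports.
Local Open Scope classical_set_scope.
Local Open Scope complex_scope.
Local Open Scope ring_scope.

(** Write z = x + i y with x, y real. Since phi(z, omega, t) is a multiple of
the square of sigma = z omega - t, both of its gradients carry the factor
sigma: phi'_z = 2 i pi sigma omega, and along a tangent vector (w, s) of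
S^{n-1} x R, where w is orthogonal to omega, the derivative of phi is
2 i pi sigma (z w - s). The requirement that - phi'_zeta be the real covector
(eta, tau) therefore amounts to four equations between real quantities,

  x omega = t,   tau = - 2 pi (y omega),   eta = - tau (x - t omega),
  tau y = tau (y omega) omega,

which form [kappa_graph], and under these equations phi'_z = tau omega. That
they are equivalent to the requirement is [neg_phi_zetaP]. Sufficiency is the
chain rule in an arbitrary chart: the first component of a derivative of a
chart is orthogonal to omega because the chart takes values on the sphere.
Necessity needs only one chart, and the inverse stereographic projection from
- omega, expressed in the ambient coordinates of R^n, is one: [stereo] is
rational, and its derivatives at the origin are all the tangent vectors.

The equations are invariant under the antipodal map ([kappa_graph_opp]), so
that they describe kappa_B on T^*(P^n) ([kappaB_class]), and both formulas of
the theorem come from solving them. When tau is nonzero, x and y are determined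
by the covector. Conversely, for y = - xi and 2 pi xi = tau omega the covector
is determined by the number rho = xi omega, whose square is |xi|^2: the two
signs of rho give the two antipodal representatives. *)

(** * The bilinear product *)

Section Dot.
Variables (K : comNzRingType) (n : nat).
Implicit Types u v w : 'rV[K]_n.

Lemma dotC u v : dot u v = dot v u.
Proof. by apply: eq_bigr => k _; rewrite mulrC. Qed.

Lemma dot_is_bilinear :
  bilinear_for (GRing.Scale.Law.clone _ _ *%R _) (GRing.Scale.Law.clone _ _ *%R _)
    (@dot K n).
Proof.
have dotPl w a u v : dot (a *: u + v) w = a * dot u w + dot v w.
  rewrite /dot big_distrr /= -big_split /=.
  by apply: eq_bigr => k _; rewrite !mxE mulrDl mulrA.
by split=> // w a u v; rewrite !(dotC w) dotPl.
Qed.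

HB.instance Definition _ :=
  bilinear_isBilinear.Build K _ _ _ _ _ (@dot K n) dot_is_bilinear.

Lemma dotDl u v w : dot (u + v) w = dot u w + dot v w.
Proof. exact: linearDl. Qed.
Lemma dotDr u v w : dot u (v + w) = dot u v + dot u w.
Proof. exact: linearDr. Qed.
Lemma dotZl a u v : dot (a *: u) v = a * dot u v.
Proof. exact: linearZl_LR. Qed.
Lemma dotZr a u v : dot u (a *: v) = a * dot u v.
Proof. exact: linearZr_LR. Qed.
Lemma dotNl u v : dot (- u) v = - dot u v.
Proof. exact: linearNl. Qed.
Lemma dotNr u v : dot u (- v) = - dot u v.
Proof. exact: linearNr. Qed.
Lemma dot0l u : dot 0 u = 0.
Proof. exact: linear0l. Qed.

Definition dotE := (dotDl, dotDr, dotNl, dotNr, dotZl, dotZr).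

Lemma dot_delta u k : dot u (delta_mx 0 k) = u 0 k.
Proof.
rewrite /dot (bigD1 k) //= mxE !eqxx mulr1 big1 ?addr0// => j jk.
by rewrite mxE (negPf jk) mulr0.
Qed.

End Dot.

Lemma dot_ge0 (R : realType) n (v : 'rV[R]_n) : 0 <= dot v v.
Proof. by apply: sumr_ge0 => k _; rewrite -expr2 sqr_ge0. Qed.

Lemma dot_eq0 (R : realType) n (v : 'rV[R]_n) : (dot v v == 0) = (v == 0).
Proof.
apply/eqP/eqP => [|->]; last by rewrite dot0l.
move/psumr_eq0P => v0; apply/rowP => k; apply/eqP.
by rewrite mxE -sqrf_eq0 expr2 v0// => j _; rewrite -expr2 sqr_ge0.
Qed.

(** * Differential calculus *)

Section Differentials.
Variables (K : numFieldType) (V : normedModType K).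

(** The product rule; it is applied to the inner product and to the product of
a scalar function with a vector-valued one. *)
Lemma is_diff_bilinear (U W X : normedModType K) (b : {bilinear U -> W -> X})
    (f df : V -> U) (g dg : V -> W) x :
  continuous (fun p : U * W => b p.1 p.2) -> is_diff x f df -> is_diff x g dg ->
  is_diff x (fun y => b (f y) (g y)) (fun v => b (f x) (dg v) + b (df v) (g x)).
Proof.
move=> bc fx gx.
have bx : is_diff (f x, g x) (fun p : U * W => b p.1 p.2)
    (fun p => b (f x) p.2 + b p.1 (g x)).
  by apply: DiffDef; [exact: differentiable_bilin|exact: diff_bilin].
exact: (is_diff_comp (is_diff_pair fx gx) bx).
Qed.

Lemma dot_continuous n : continuous (fun p : 'rV[K]_n * 'rV[K]_n => dot p.1 p.2).
Proof.
move=> p; apply: (cvg_big add_continuous) => k _.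
pose e (u : 'rV[K]_n) : K := u 0 k.
have ec u : e @ u --> e u by exact: coord_continuous.
apply: cvgM.
  by apply: (cvg_comp fst e _ (ec p.1)); apply: cvg_fst.
by apply: (cvg_comp snd e _ (ec p.2)); apply: cvg_snd.
Qed.

Lemma is_diff_dot n (f df g dg : V -> 'rV[K]_n) x :
  is_diff x f df -> is_diff x g dg ->
  is_diff x (fun y => dot (f y) (g y))
    (fun v => dot (f x) (dg v) + dot (df v) (g x)).
Proof. exact/is_diff_bilinear/dot_continuous. Qed.

Lemma is_diff_dotr n (f df : V -> 'rV[K]_n) c x :
  is_diff x f df -> is_diff x (fun y => dot (f y) c) (fun v => dot (df v) c).
Proof.
move=> fx; apply: (is_diff_eq (is_diff_dot fx (is_diff_cst c x))).
by apply/funext => v; rewrite linear0r add0r.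
Qed.

Lemma is_diff_scale (W : normedModType K) (f df : V -> K) (g dg : V -> W) x :
  is_diff x f df -> is_diff x g dg ->
  is_diff x (fun y => f y *: g y) (fun v => f x *: dg v + df v *: g x).
Proof.
have sb : bilinear_for (GRing.Scale.Law.clone _ _ *:%R _)
    (GRing.Scale.Law.clone _ _ *:%R _) (fun (a : K^o) (w : W) => a *: w).
  split=> [w a u v|u a w z] /=; first by rewrite scalerDl scalerA.
  by rewrite scalerDr !scalerA mulrC.
pose sB := bilinear_isBilinear.Build K K^o W W _ _ _ sb.
pose sL : {bilinear K^o -> W -> W} := HB.pack (fun (a : K^o) (w : W) => a *: w) sB.
exact: (@is_diff_bilinear K^o W W sL _ _ _ _ _ (@scale_continuous _ _)).
Qed.

Lemma is_diff_scale_cst (W : normedModType K) (f df : V -> K) (c : W) x :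
  is_diff x f df -> is_diff x (fun y => f y *: c) (fun v => df v *: c).
Proof.
move=> fx; apply: (is_diff_eq (is_diff_scale fx (is_diff_cst c x))).
by apply/funext => v; rewrite scaler0 add0r.
Qed.

Lemma is_diff_translate (W : normedModType K) (f df : V -> W) (c : W) x :
  is_diff x f df -> is_diff x (fun y => c + f y) df.
Proof.
by move=> fx; apply: (is_diff_eq (is_diffD (is_diff_cst c x) fx)); rewrite add0r.
Qed.

Lemma is_diff_inv (f df : V -> K) x : is_diff x f df -> f x != 0 ->
  is_diff x (fun y => (f y)^-1) (fun v => - (f x) ^- 2 * df v).
Proof.
move=> fx fx0; apply: DiffDef; first exact: differentiableV.
by rewrite diffV// diff_val.
Qed.

Lemma is_diff_fst (U W : normedModType K) (f df : V -> U * W) x :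
  is_diff x f df -> is_diff x (fun y => (f y).1) (fun v => (df v).1).
Proof.
move=> fx; have fstc : continuous (fst : {linear (U * W)%type -> U}).
  by move=> p; apply: cvg_fst.
apply: (is_diff_comp fx); apply: DiffDef; first exact: linear_differentiable.
exact: diff_lin.
Qed.

Lemma is_diff_snd (U W : normedModType K) (f df : V -> U * W) x :
  is_diff x f df -> is_diff x (fun y => (f y).2) (fun v => (df v).2).
Proof.
move=> fx; have sndc : continuous (snd : {linear (U * W)%type -> W}).
  by move=> p; apply: cvg_snd.
apply: (is_diff_comp fx); apply: DiffDef; first exact: linear_differentiable.
exact: diff_lin.
Qed.

Lemma is_diffDv (W : normedModType K) (f df : V -> W) x v :
  is_diff x f df -> 'D_v f x = df v.
Proof. by move=> fx; rewrite deriveE// diff_val. Qed.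

End Differentials.

(** For [K] the complex numbers this is the holomorphic derivative of the phase; the
topology of the complex numbers is the one they carry as a [numFieldType]. *)
Lemma derive_sqr_affine (K : numFieldType) n (c : 'rV[K]_n) (a b : K) z v :
  'D_v (fun z' => a * (dot z' c - b) ^+ 2 : K^o) z =
  2 * a * (dot z c - b) * dot v c.
Proof.
have lz := is_diff_translate (- b) (is_diff_dotr c (is_diff_id z)).
have pz := is_diffZ a (is_diffM lz lz).
rewrite (_ : (fun z' => _) = a *: ((fun y => - b + dot (id y) c) *
    (fun y => - b + dot (id y) c))); last first.
  by apply/funext => z'; rewrite addrC expr2.
rewrite (is_diffDv _ pz).
set s := dot z c; set s' := dot v c.
suff : a * ((- b + s) * s' + (- b + s) * s') = 2 * a * (s - b) * s' :> K by [].
by ring.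
Qed.

(** * A chart of the sphere given by stereographic projection *)

Section Chart.
Variables (R : realType) (n : nat) (omega : 'rV[R]_n) (t : R).
Hypothesis omega1 : dot omega omega = 1.

Definition tangent_part (y : 'rV[R]_n) : 'rV[R]_n := y - dot y omega *: omega.

Lemma dot_tangent_part v : dot (tangent_part v) omega = 0.
Proof. by rewrite !dotE omega1 mulr1 subrr. Qed.

Definition stereo_den (y : 'rV[R]_n) : R := 1 + dot (tangent_part y) (tangent_part y).

Lemma stereo_den_gt0 y : 0 < stereo_den y.
Proof. by rewrite ltr_pwDl ?dot_ge0. Qed.

(** The orthogonal complement of [omega] is the hyperplane onto which the unit
sphere minus [- omega] is projected from the point [- omega]; [tangent_part y] is
the projected point. The remaining coordinate of [y], its component along
[omega], is used for the variable t, so that no basis of the complement has to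
be chosen. *)
Definition stereo (y : 'rV[R]_n) : 'rV[R]_n * R :=
  (- omega + (2 / stereo_den y) *: (omega + tangent_part y), t + 2 * dot y omega).

(** The factor 4 collects the 2 of [stereo] and the 2 coming from the derivative
of the square in [stereo_den]. *)
Definition dstereo (y v : 'rV[R]_n) : 'rV[R]_n * R :=
  ((2 / stereo_den y) *: tangent_part v -
   (4 * dot (tangent_part y) (tangent_part v) * (stereo_den y)^-1 ^+ 2) *:
     (omega + tangent_part y),
   2 * dot v omega).

(** With w the tangential part and d = 1 + w^2, the vector omega + w has square
d and inner product 1 with omega, so the square is
(2 / d)^2 d - 2 (2 / d) + 1 = 1. *)
Lemma stereo_sphere y : dot (stereo y).1 (stereo y).1 = 1.
Proof.
rewrite /stereo /=; move: (dot_tangent_part y) (stereo_den_gt0 y).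
rewrite /stereo_den; move: (tangent_part y) => w wo d0.
by rewrite !dotE (dotC omega w) wo omega1; field; rewrite gt_eqF.
Qed.

Lemma is_diff_tangent_part (V : normedModType R) (f df : V -> 'rV[R]_n) x :
  is_diff x f df -> is_diff x (fun y => tangent_part (f y)) (fun v => tangent_part (df v)).
Proof.
move=> fx; have fo := is_diff_dotr omega fx.
by apply: (is_diff_eq (is_diffB fx (is_diff_scale_cst omega fo))).
Qed.

Lemma is_diff_stereo_den y :
  is_diff y stereo_den (fun v => 2 * dot (tangent_part y) (tangent_part v)).
Proof.
have Ty := is_diff_tangent_part (is_diff_id y).
apply: (is_diff_eq (is_diff_translate (1 : R) (is_diff_dot Ty Ty))).
by apply/funext => v; rewrite (dotC (tangent_part v)) mulr_natl.
Qed.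

Lemma is_diff_stereo y : is_diff y stereo (dstereo y).
Proof.
have d0 : stereo_den y != 0 by rewrite gt_eqF// stereo_den_gt0.
have Ty := is_diff_tangent_part (is_diff_id y).
have gy := is_diffZ (2 : R) (is_diff_inv (is_diff_stereo_den y) d0).
have wy := is_diff_translate omega Ty.
have ly := is_diffZ (2 : R) (is_diff_dotr omega (is_diff_id y)).
apply: (is_diff_eq (is_diff_pair (is_diff_translate (- omega) (is_diff_scale gy wy))
   (is_diff_translate t ly))).
apply/funext => v; rewrite /dstereo; congr (_, _).
rewrite -scaleNr; congr (_ + _ *: _).
transitivity (2 * (- stereo_den y ^- 2 * (2 * dot (tangent_part y) (tangent_part v)))) => //.
by field.
Qed.

(** Here the base point varies and the direction is fixed: this is the
continuity of the derivative demanded of a chart. *)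
Lemma differentiable_dstereo v y : differentiable (fun x => dstereo x v) y.
Proof.
have d0 : stereo_den y != 0 by rewrite gt_eqF// stereo_den_gt0.
have Ty := is_diff_tangent_part (is_diff_id y).
have iy := is_diff_inv (is_diff_stereo_den y) d0.
have wy := is_diff_translate omega Ty.
have ny := is_diffZ (4 : R) (is_diff_dotr (tangent_part v) Ty).
have [+ _] := is_diff_pair
  (is_diffB (is_diff_scale_cst (tangent_part v) (is_diffZ (2 : R) iy))
     (is_diff_scale (is_diffM ny (is_diffM iy iy)) wy))
  (is_diff_cst (2 * dot v omega : R) y).
by [].
Qed.

Lemma derive_stereo0 v : 'D_v stereo 0 = (2 *: tangent_part v, 2 * dot v omega).
Proof.
rewrite (is_diffDv _ (is_diff_stereo 0)) /dstereo /stereo_den.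
have -> : tangent_part 0 = 0 by rewrite /tangent_part dot0l scale0r subr0.
by rewrite !dot0l mulr0 mul0r scale0r addr0 divr1 subr0.
Qed.

(** The derivative at 0 is twice the decomposition of a vector into its
tangential part and its component along [omega], hence injective. *)
Lemma local_coord_stereo : local_coord stereo 0 omega t.
Proof.
split.
- rewrite /stereo /stereo_den.
  have -> : tangent_part 0 = 0 by rewrite /tangent_part dot0l scale0r subr0.
  rewrite !dot0l !addr0 mulr0 addr0 divr1; congr (_, _).
  by rewrite scaler_nat mulr2n addKr.
- by near=> y; exact: stereo_sphere.
- near=> y; split; first by have [] := is_diff_stereo y.
  move=> v; have -> : (fun x => 'D_v stereo x) = dstereo^~ v.
    by apply/funext => x; rewrite (is_diffDv _ (is_diff_stereo x)).
  exact/differentiable_continuous/differentiable_dstereo.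
- move=> v; rewrite derive_stereo0 => -[/eqP + /eqP].
  rewrite scaler_eq0 mulf_eq0 pnatr_eq0 /= /tangent_part => + /eqP vo.
  by rewrite vo scale0r subr0 => /eqP.
Unshelve. all: by end_near. Qed.

End Chart.

(** * The equations of the canonical transform *)

Section Phase.
Variables (R : realType) (n : nat).
Implicit Types (x y xi eta omega w : 'rV[R]_n) (t tau : R) (z : 'rV[R[i]]_n).

Lemma complex_rect_eq (a b c d : R) :
  a%:C + 'i * b%:C = c%:C + 'i * d%:C -> a = c /\ b = d.
Proof. by rewrite -complexiE; simpc => -[]. Qed.

Lemma Re_rectC (a b : R) : complex.Re (a%:C + 'i * b%:C) = a.
Proof. by rewrite -complexiE; simpc. Qed.

Lemma Im_rectC (a b : R) : complex.Im (a%:C + 'i * b%:C) = b.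
Proof. by rewrite -complexiE; simpc. Qed.

Lemma dot_cvec x w : dot (cvec x) (cvec w) = (dot x w)%:C.
Proof. by rewrite /dot rmorph_sum; apply: eq_bigr => k _; rewrite !mxE rmorphM. Qed.

Lemma cvecB x y : cvec (x - y) = cvec x - cvec y.
Proof. exact: raddfB. Qed.
Lemma cvecZ a x : cvec (a *: x) = a%:C *: cvec x.
Proof. exact: map_mxZ. Qed.

Lemma cvec_rect_inj x y x' y' :
  cvec x + 'i *: cvec y = cvec x' + 'i *: cvec y' -> x = x' /\ y = y'.
Proof.
move=> /rowP e.
by split; apply/rowP => k; move: (e k); rewrite !mxE => /complex_rect_eq[].
Qed.

Lemma cvec_inj : injective (@cvec R n).
Proof.
move=> x y xy.
by have [] : x = y /\ (0 : 'rV[R]_n) = 0 by apply: cvec_rect_inj; rewrite xy.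
Qed.

Lemma cvec_rect z : exists x y, z = cvec x + 'i *: cvec y.
Proof.
exists (map_mx (@complex.Re R) z), (map_mx (@complex.Im R) z).
by apply/rowP => k; rewrite !mxE -complexiE -complexE.
Qed.

Lemma cgrad_phi z omega t : cgrad (fun z' => phi z' omega t) z =
  ('i * (2 * pi : R)%:C * (dot z (cvec omega) - t%:C)) *: cvec omega.
Proof.
apply/rowP => k; rewrite !mxE.
rewrite (derive_sqr_affine (cvec omega)) (dotC (delta_mx 0 k)) dot_delta mxE rmorphM
  rmorph_nat.
by ring.
Qed.

(** With a = x omega - t and b = y omega the phase is
i pi (a + i b)^2 = - 2 pi a b + i pi (a^2 - b^2). *)
Lemma rgrad_phi x y omega t (P : 'rV[R]_n -> 'rV[R]_n * R) u k :
  differentiable P u -> P u = (omega, t) ->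
  let dP := 'D_(delta_mx 0 k) P u in
  let a := dot x omega - t in let b := dot y omega in
  let da := dot x dP.1 - dP.2 in let db := dot y dP.1 in
  rgrad (fun y' => phi (cvec x + 'i *: cvec y) (P y').1 (P y').2) u 0 k =
    (- (2 * pi * (da * b + a * db))) +i* (2 * pi * (a * da - b * db)).
Proof.
move=> /differentiableP Pu Put dP a b da db; rewrite mxE.
pose fa p := dot (P p).1 x - (P p).2.
pose fb p := dot (P p).1 y.
have phiE p : phi (cvec x + 'i *: cvec y) (P p).1 (P p).2 =
    (- (2 * pi) * (fa p * fb p))%:C + 'i * (pi * (fa p * fa p - fb p * fb p))%:C.
  rewrite /phi dotDl dotZl !dot_cvec /fa /fb ![dot (P p).1 _]dotC.
  rewrite !(rmorphM, rmorphB, rmorphN) /= -!complexiE.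
  by simpc; congr (_ +i* _); ring.
have -> : (fun p => complex.Re (phi (cvec x + 'i *: cvec y) (P p).1 (P p).2)) =
    (- (2 * pi)) *: (fa * fb).
  by apply/funext => p; rewrite phiE Re_rectC.
have -> : (fun p => complex.Im (phi (cvec x + 'i *: cvec y) (P p).1 (P p).2)) =
    (pi : R) *: (fa * fa - fb * fb).
  by apply/funext => p; rewrite phiE Im_rectC.
have fau : is_diff u fa _ := is_diffB (is_diff_dotr x (is_diff_fst Pu)) (is_diff_snd Pu).
have fbu : is_diff u fb _ := is_diff_dotr y (is_diff_fst Pu).
have Hre := is_diffZ (- (2 * pi) : R) (is_diffM fau fbu).
have Him := is_diffZ (pi : R) (is_diffB (is_diffM fau fau) (is_diffM fbu fbu)).
rewrite (is_diffDv _ Hre) (is_diffDv _ Him).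
have ea : fa u = a by rewrite /fa Put (dotC omega).
have eb : fb u = b by rewrite /fb Put (dotC omega).
have eP : dP = 'd P u (delta_mx 0 k) by rewrite /dP deriveE//; case: Pu.
suff : (- (2 * pi) * (fa u * db + fb u * da)) +i*
    (pi * (fa u * da + fa u * da - (fb u * db + fb u * db))) =
    (- (2 * pi * (da * b + a * db))) +i* (2 * pi * (a * da - b * db)).
  by rewrite /da /db eP !(dotC _ ('d P u (delta_mx 0 k)).1).
by rewrite ea eb; congr (_ +i* _); ring.
Qed.

(** A velocity of a curve on the sphere is orthogonal to its position: the
derivative of (P y).1 (P y).1 = 1 vanishes. *)
Lemma local_coord_tangent (P : 'rV[R]_n -> 'rV[R]_n * R) u omega t v :
  local_coord P u omega t -> dot omega ('D_v P u).1 = 0.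
Proof.
move=> [Pu Psphere /nbhs_singleton[dP _] _].
have Pdiff := is_diff_fst (differentiableP dP).
have := is_diffDv v (is_diff_dot Pdiff Pdiff).
rewrite (near_eq_derive (g := cst (1 : R))) // derive_cst Pu deriveE//= => /esym/eqP.
by rewrite (dotC _ omega) -mulr2n mulrn_eq0 /= => /eqP.
Qed.

Lemma real_eq_oppC (a b c : R) : a%:C = - (b +i* c) <-> a = - b /\ c = 0.
Proof.
rewrite -[- (b +i* c)]/((- b) +i* (- c)); split=> [[-> /esym/eqP]|[-> ->]].
  by rewrite oppr_eq0 => /eqP ->.
by rewrite oppr0.
Qed.

(** The values z = x + i y for which (eta, tau) is - phi'_zeta. Tangentially to
the sphere the real part gives eta and the imaginary part the last equation,
which says that y is parallel to omega as soon as tau is nonzero. *)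
Definition kappa_graph omega t eta tau x y : Prop :=
  [/\ dot x omega = t, tau = - (2 * pi * dot y omega),
      eta = - tau *: (x - t *: omega) & tau *: y = (tau * dot y omega) *: omega].

(** For necessity, the chart [stereo] gives one real and one imaginary equation
for each coordinate k. Taken together over k they are two vector equations, [E1]
and [E2], and pairing these with omega yields a = 0 from [E2] and then the
value of tau from [E1]. *)
Lemma neg_phi_zetaP x y omega t eta tau :
  dot omega omega = 1 -> dot eta omega = 0 ->
  neg_phi_zeta (cvec x + 'i *: cvec y) omega t eta tau <->
  kappa_graph omega t eta tau x y.
Proof.
move=> o1 eo; split=> [H|[xo tE -> ty] P u Pu k /=]; last first.
  have [Puo _ /nbhs_singleton[dP _] _] := Pu.
  have wo := local_coord_tangent (delta_mx 0 k) Pu.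
  rewrite (rgrad_phi _ _ _ dP Puo); move: ('D_(delta_mx 0 k) P u) wo => [w s] /= wo.
  have tyw : tau * dot y w = 0 by rewrite -dotZl ty dotZl wo mulr0.
  rewrite xo subrr !mul0r add0r addr0 !dotE wo.
  apply/real_eq_oppC; split; first by rewrite [in RHS]mulrA [in RHS]mulrAC tE; ring.
  by move: tyw; rewrite tE => tyw; lra.
have Sdiff : differentiable (stereo omega t) 0 by have [] := is_diff_stereo omega t 0.
have [S0 _ _ _] := local_coord_stereo t o1.
pose a := dot x omega - t; pose b := dot y omega.
have Hk k : eta 0 k + tau * omega 0 k = 2 * pi *
      (b * (x 0 k - dot x omega * omega 0 k - omega 0 k) + a * (y 0 k - b * omega 0 k)) /\
    a * (x 0 k - dot x omega * omega 0 k - omega 0 k) = b * (y 0 k - b * omega 0 k).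
  move: (H _ _ (local_coord_stereo t o1) k) => /=.
  rewrite (rgrad_phi _ _ _ Sdiff S0) derive_stereo0 /= /tangent_part !dotE.
  rewrite (dotC (delta_mx 0 k)) !dot_delta -/a -/b eo => /real_eq_oppC[E1 E2].
  split; first by lra.
  by have := pi_gt0 R; nra.
have E1 : eta + tau *: omega = (2 * pi) *:
    (b *: (x - dot x omega *: omega - omega) + a *: (y - b *: omega)).
  by apply/rowP => k; rewrite !mxE (Hk k).1.
have E2 : a *: (x - dot x omega *: omega - omega) = b *: (y - b *: omega).
  by apply/rowP => k; rewrite !mxE (Hk k).2.
have a0 : a = 0.
  by move: (congr1 (fun u => dot u omega) E2); rewrite !dotE o1 -/b; lra.
have tE : tau = - (2 * pi * b).
  by move: (congr1 (fun u => dot u omega) E1); rewrite !dotE o1 eo -/b a0; lra.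
have xo : dot x omega = t by apply/eqP; rewrite -subr_eq0; exact/eqP.
split=> //.
- rewrite -[LHS](addrK (tau *: omega)) E1 a0 scale0r addr0 xo tE.
  by apply/rowP => k; rewrite !mxE; ring.
- move/eqP: E2; rewrite a0 scale0r eq_sym scalerBr subr_eq0 => /eqP yE.
  by rewrite tE -!scalerA -/b !scaleNr -!scalerA yE.
Qed.

Lemma cgrad_phi_kappa_graph x y omega t eta tau :
  kappa_graph omega t eta tau x y ->
  cgrad (fun z => phi z omega t) (cvec x + 'i *: cvec y) = tau%:C *: cvec omega.
Proof.
move=> [xo tE _ _]; rewrite cgrad_phi dotDl dotZl !dot_cvec xo tE; congr (_ *: _).
rewrite addrAC subrr add0r rmorphN rmorphM -mulN1r -mulCii.
by ring.
Qed.

Lemma kappa_graph_opp omega t eta tau x y :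
  kappa_graph (- omega) (- t) (- eta) (- tau) x y <->
  kappa_graph omega t eta tau x y.
Proof.
suff im o t' e ta : kappa_graph o t' e ta x y ->
    kappa_graph (- o) (- t') (- e) (- ta) x y.
  by split=> /im; rewrite ?opprK.
move=> [xo tE eE yE]; split.
- by rewrite dotNr xo.
- by rewrite dotNr mulrN opprK tE opprK.
- by rewrite eE -scaleNr; congr (_ *: (_ - _)); rewrite scaleNr scalerN opprK.
- by rewrite dotNr mulrNN scalerN -yE scaleNr.
Qed.

Lemma cotS_dot (q : cotS R n) omega t eta tau :
  val q = (omega, t, eta, tau) -> dot omega omega = 1 /\ dot eta omega = 0.
Proof. by move=> qE; have := valP q; rewrite qE /= => /andP[/eqP-> /eqP->]. Qed.

(** Another representative of the class is the covector itself or its opposite,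
and neither the equations nor the fibre variable tau omega distinguish the two. *)
Lemma kappaB_class (q : cotS R n) omega t eta tau x y zeta :
  val q = (omega, t, eta, tau) ->
  kappaB (cotP_class q) (cvec x + 'i *: cvec y, zeta) <->
  kappa_graph omega t eta tau x y /\ zeta = tau%:C *: cvec omega.
Proof.
move=> qE; have [ omega1 etao] := cotS_dot qE; split.
- move=> [q' [z]]; case q'E: (val q') => [[[w' t'] e'] ta'] [q'q Hz [zE ->]].
  have [ omega'1 e'o'] := cotS_dot q'E.
  move: Hz; rewrite -zE => /(neg_phi_zetaP _ _ _ _ omega'1 e'o') G.
  move/eqmodP: q'q; rewrite /= /antipodal q'E qE.
  case/orP=> /eqP[eqo eqt eqe eqta]; rewrite (cgrad_phi_kappa_graph G) //.
    by rewrite -eqo -eqt -eqe -eqta.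
  split; first by apply/kappa_graph_opp; rewrite -eqo -eqt -eqe -eqta.
  by rewrite eqo eqta rmorphN /cvec raddfN scaleNr scalerN opprK.
- move=> [G ->]; exists q, (cvec x + 'i *: cvec y); rewrite qE; split=> //.
    exact/neg_phi_zetaP.
  by rewrite (cgrad_phi_kappa_graph G).
Qed.

End Phase.

(** * Solving the equations *)

Section Values.
Variables (R : realType) (n : nat).
Implicit Types (x y xi eta omega : 'rV[R]_n) (t tau : R).

Lemma kappa_value_rect omega t eta tau :
  t%:C *: cvec omega - cvec eta - ('i * tau%:C) *: cvec omega =
  cvec (t *: omega - eta) + 'i *: cvec (- tau *: omega).
Proof.
by rewrite cvecB !cvecZ rmorphN scaleNr scalerN scalerA.
Qed.

(** Since 2 pi tau is nonzero, it cancels in the last two equations: they read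
eta = t omega - x and y = (y omega) omega, and y omega = - tau. *)
Lemma kappa_graph_valueP omega t eta tau x y :
  dot omega omega = 1 -> dot eta omega = 0 -> tau != 0 ->
  kappa_graph omega t ((2 * pi * tau) *: eta) (2 * pi * tau) x y <->
  x = t *: omega - eta /\ y = - tau *: omega.
Proof.
move=> omega1 etao tau0; have c0 : 2 * pi * tau != 0 :> R.
  by rewrite !mulf_neq0// gt_eqF// pi_gt0.
split=> [[xo tE etaE yE]|[-> ->]].
  split.
    have -> : eta = t *: omega - x.
      by apply: (scalerI c0); rewrite etaE scaleNr -scalerN opprB.
    by rewrite opprB addrC subrK.
  have -> : y = dot y omega *: omega by apply: (scalerI c0); rewrite yE scalerA.
  congr (_ *: _); have := pi_gt0 R => pi0.
  apply: (mulfI (_ : 2 * pi != 0 :> R)); first by rewrite mulf_neq0// gt_eqF.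
  by rewrite mulrN tE opprK.
split; rewrite ?dotE ?omega1 ?etao.
- by rewrite mulr1 subr0.
- by ring.
- by rewrite addrAC subrr add0r scalerN scaleNr opprK.
- by rewrite !scalerA mulr1.
Qed.

Lemma kappa_graph_zero omega t x : dot x omega = t -> kappa_graph omega t 0 0 x 0.
Proof.
by move=> xo; split=> //; rewrite ?dot0l ?mulr0 ?oppr0 ?scale0r//.
Qed.

Lemma Lambda_PhiP x y zeta : @Lambda_Phi R n (cvec x + 'i *: cvec y, zeta) <->
  zeta = - ((2 * pi)%:C *: cvec y).
Proof.
have Nrect x' xi : cvec x' - 'i *: cvec xi = cvec x' + 'i *: cvec (- xi).
  by rewrite /cvec raddfN scalerN.
split=> [[x' [xi [/[!Nrect] /cvec_rect_inj[_ ->] ->]]]|->].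
  by rewrite /cvec raddfN scalerN opprK.
by exists x, (- y); rewrite Nrect opprK /cvec raddfN scalerN.
Qed.

(** The claimed preimage of (x - i xi, 2 pi xi), with an arbitrary number rho in
place of |xi|: the opposite covector is then the value at - rho, and both signs
are treated at once. *)
Definition point_over x xi (rho : R) : covec R n :=
  (rho^-1 *: xi, dot x xi / rho,
   (2 * pi * rho) *: (- x + (dot x xi / rho ^+ 2) *: xi), 2 * pi * rho).

Lemma point_overN x xi rho : point_over x xi (- rho) = - point_over x xi rho.
Proof.
by rewrite /point_over sqrrN invrN !mulrN !scaleNr.
Qed.

Lemma point_over_covec x xi rho : rho != 0 -> rho ^+ 2 = dot xi xi ->
  is_covec (point_over x xi rho).
Proof.
move=> rho0 rhoE; rewrite /is_covec /point_over !dotE -rhoE.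
by apply/andP; split; apply/eqP; field.
Qed.

(** Here y = - xi, and comparing the fibre variables gives 2 pi xi = tau omega.
Hence xi = rho omega for rho = xi omega, tau = 2 pi rho, and omega, t and eta
follow by dividing by rho. *)
Lemma kappaB_point_overP (q : cotS R n) x xi : xi != 0 ->
  kappaB (cotP_class q) (cvec x - 'i *: cvec xi, (2 * pi)%:C *: cvec xi) <->
  exists2 rho, rho ^+ 2 = dot xi xi & val q = point_over x xi rho.
Proof.
move=> xi0; have pi20 : 2 * pi != 0 :> R by rewrite mulf_neq0// gt_eqF// pi_gt0.
have -> : cvec x - 'i *: cvec xi = cvec x + 'i *: cvec (- xi).
  by rewrite /cvec raddfN scalerN.
case qE: (val q) => [[[omega t] eta] tau]; have [ omega1 etao] := cotS_dot qE.
rewrite (kappaB_class _ _ _ qE) -!cvecZ; split=> [[[xo tE etaE yE] zetaE]|].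
  have {}zetaE := cvec_inj zetaE.
  pose rho := dot xi omega.
  have tauE : tau = 2 * pi * rho by rewrite tE dotNl mulrN opprK.
  have xiE : xi = rho *: omega.
    by apply: (scalerI pi20); rewrite zetaE tauE scalerA.
  have rho0 : rho != 0 by apply: contraNneq xi0 => r0; rewrite xiE r0 scale0r.
  exists rho; first by rewrite xiE !dotE omega1 mulr1 expr2.
  have omegaE : omega = rho^-1 *: xi by rewrite xiE scalerA mulVf// scale1r.
  have tE' : t = dot x xi / rho by rewrite -xo omegaE dotZr mulrC.
  rewrite /point_over -tauE -omegaE -tE'; congr (_, _, _, _).
  rewrite etaE scaleNr -scalerN opprB addrC; congr (_ *: (_ + _)).
  by rewrite tE' omegaE scalerA; congr (_ *: _); field.
move=> [rho rhoE [-> -> -> ->]].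
have rho0 : rho != 0.
  by apply: contraNneq xi0 => r0; rewrite -dot_eq0 -rhoE r0 expr0n.
split; last first.
  by congr cvec; rewrite scalerA mulfK.
split.
- by rewrite dotZr mulrC.
- by rewrite !dotE -rhoE; field.
- by apply/rowP => k; rewrite !mxE; field.
- by rewrite !dotE -rhoE; apply/rowP => k; rewrite !mxE; field.
Qed.

End Values.

Theorem theorem3 (R : realType) (n : nat) (hn : (2 <= n)%N) :
  (forall (q : cotS R n) (omega : 'rV[R]_n) (t : R) (eta : 'rV[R]_n) (tau : R),
     val q = (omega, t, (2 * pi * tau) *: eta, 2 * pi * tau) ->
     dot eta omega = 0 ->
     let value (eta' : 'rV[R]_n) : 'rV[R[i]]_n * 'rV[R[i]]_n :=
       (t%:C *: cvec omega - cvec eta' - ('i * tau%:C) *: cvec omega,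
        (2 * pi * tau)%:C *: cvec omega) in
     [/\ kappaB (cotP_class q) (value eta),
         tau != 0 -> kappaB (cotP_class q) = [set value eta] &
         tau = 0 -> kappaB (cotP_class q) `&` @Lambda_Phi R n =
                    [set value eta' | eta' in [set eta' | dot eta' omega = 0]]])
  /\
  (forall x xi : 'rV[R]_n, xi != 0 ->
     let q0 : covec R n :=
       ((enorm xi)^-1 *: xi,
        dot x xi / enorm xi,
        (2 * pi * enorm xi) *: (- x + (dot x xi / enorm xi ^+ 2) *: xi),
        2 * pi * enorm xi) in
     [set val q | q in [set q : cotS R n |
        kappaB (cotP_class q)
          (cvec x - 'i *: cvec xi, (2 * pi)%:C *: cvec xi)]] =
     [set q0; - q0]).
Proof.
split=> [q omega t eta tau qE etao /=|x xi xi0 /=].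
  have [ omega1 _] := cotS_dot qE.
  have kappaE := kappaB_class _ _ _ qE.
  have graph0 eta' : dot eta' omega = 0 -> tau = 0 ->
      kappa_graph omega t ((2 * pi * tau) *: eta) (2 * pi * tau)
        (t *: omega - eta') (- tau *: omega).
    move=> eta'o ->; rewrite mulr0 oppr0 !scale0r; apply: kappa_graph_zero.
    by rewrite !dotE omega1 eta'o mulr1 subr0.
  split=> [|tau0|tau0].
  - rewrite kappa_value_rect; apply/kappaE; split=> //.
    have [tau0|tau0] := eqVneq tau 0; first exact: graph0.
    exact/kappa_graph_valueP.
  - apply/seteqP; split=> [[z zeta]|_ ->]; rewrite kappa_value_rect.
      have [x [y ->]] := cvec_rect z.
      by move=> /kappaE[/(kappa_graph_valueP _ _ _ omega1 etao tau0)[-> ->] ->].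
    by apply/kappaE; split=> //; exact/kappa_graph_valueP.
  (* On the zero section Lambda_Phi forces y = 0, since the fibre variable
     tau omega = - 2 pi y vanishes. *)
  - apply/seteqP; split=> [[z zeta]|_ [eta' eta'o <-]]; last first.
      rewrite kappa_value_rect; split; first by apply/kappaE; split=> //; exact: graph0.
      by apply/Lambda_PhiP; rewrite tau0 mulr0 oppr0 !scale0r /cvec raddf0 scaler0 oppr0.
    have [x [y ->]] := cvec_rect z => -[/kappaE[[xo _ _ _] ->] /Lambda_PhiP].
    rewrite tau0 mulr0 scale0r => yE.
    have y0 : y = 0.
      have pi0 : 2 * pi != 0 :> R by rewrite mulf_neq0// gt_eqF// pi_gt0.
      apply/(scalerI pi0)/cvec_inj/oppr_inj.
      by rewrite cvecZ -yE scaler0 /cvec raddf0 oppr0.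
    exists (t *: omega - x).
      by rewrite /= !dotE xo omega1 mulr1 subrr.
    rewrite kappa_value_rect oppr0 scale0r y0.
    by have -> : t *: omega - (t *: omega - x) = x by rewrite opprB addrC subrK.
have r2 : enorm xi ^+ 2 = dot xi xi by rewrite sqr_sqrtr// dot_ge0.
have r0 : enorm xi != 0 by rewrite -sqrf_eq0 r2 dot_eq0.
rewrite -/(point_over x xi (enorm xi)); set q0 := point_over x xi _.
apply/seteqP; split=> [_ [q /(kappaB_point_overP _ _ xi0)[rho rhoE qE] <-]|q].
  move/eqP: rhoE; rewrite -r2 eqf_sqr qE => /orP[]/eqP ->; [left|right] => //.
  exact: point_overN.
move=> qE; have [rho rho0 [rhoE {}qE]] : exists2 rho, rho != 0 &
    rho ^+ 2 = dot xi xi /\ q = point_over x xi rho.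
  case: qE => ->; first by exists (enorm xi).
  by exists (- enorm xi); rewrite ?oppr_eq0// sqrrN point_overN.
have qcov : is_covec q by rewrite qE; exact: point_over_covec.
exists (exist _ q qcov : cotS R n) => //.
by apply/kappaB_point_overP => //; exists rho.
Qed.
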